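(* Let $q=2^r$ and let $\mathcal{K}$ be a translation arc in $PG(2,q)$. Then there exists a blocking set of the secants of $\mathcal{K}$ of minimum size which is contained in $\ell_\infty$.
   Context: $PG(2,q)$ is the Desarguesian projective plane over $\mathbb{F}_q$, with homogeneous coordinates $(X_1,X_2,X_3)$, and $\ell_\infty$ is the line $X_3=0$. A $k$-arc is a set of $k$ points no three of which are collinear. A secant of an arc is a line containing two (distinct) points of it. A blocking set of the secants of a $k$-arc $\mathcal{K}$ is a point set $\mathcal{B}\subset PG(2,q)\setminus\mathcal{K}$ having non-empty intersection with each secant of $\mathcal{K}$; such a set always has at least $k-1$ points, and it is said to be of minimum size if it has exactly $k-1$ points. For $A=(a_1,a_2)\in\mathbb{F}_q\times\mathbb{F}_q$ let $\varphi_A:(X_1,X_2,X_3)\mapsto(X_1+a_1X_3,\,X_2+a_2X_3,\,X_3)$. For an additive subgroup $G$ of $\mathbb{F}_q\times\mathbb{F}_q$ and a point $P\in PG(2,q)\setminus\ell_\infty$, let $\mathcal{K}_G(P)=\{\varphi_A(P)\mid A\in G\}$. A translation arc is an arc in $PG(2,q)$ coinciding with $\mathcal{K}_G(P)$ for some additive subgroup $G$ of $\mathbb{F}_q\times\mathbb{F}_q$ and some $P\in PG(2,q)\setminus \ell_\infty$. *)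

(* Defs.v *)
From HB Require Import structures.
From mathcomp Require Import all_boot all_order all_algebra.

Set Implicit Arguments.
Unset Strict Implicit.
Unset Printing Implicit Defensive.

Import GRing.Theory.
Local Open Scope ring_scope.

(* PG(2,q) over the field F with q elements: the points and the lines are the
   subspaces of F^3 of dimension 1 and 2, and incidence is inclusion.
   The homogeneous coordinates X_1, X_2, X_3 of the point spanned by v are
   v 0 0, v 0 1, v 0 2. *)

Record point (F : finFieldType) := Point {
  point_space :> {vspace 'rV[F]_3};
  dim_point : \dim point_space == 1%N }.

Record line (F : finFieldType) := Line {
  line_space :> {vspace 'rV[F]_3};
  dim_line : \dim line_space == 2%N }.

HB.instance Definition _ (F : finFieldType) := [isSub for @point_space F].
HB.instance Definition _ (F : finFieldType) := [Choice of point F by <:].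

Section PointFinite.
Variable F : finFieldType.

Definition point_mx (P : point F) := VectorInternalTheory.vs2mx P.
Definition mx_point (M : 'M[F]_(dim 'rV[F]_3)) : option (point F) := insub (VectorInternalTheory.mx2vs M).

Lemma point_mxK : pcancel point_mx mx_point.
Proof. by move=> P; rewrite /mx_point /point_mx VectorInternalTheory.vs2mxK valK. Qed.

HB.instance Definition _ := PCanIsCountable point_mxK.
HB.instance Definition _ : isFinite (point F) := PCanIsFinite point_mxK.

End PointFinite.

Definition on_line (F : finFieldType) (P : point F) (l : line F) : bool :=
  (P <= l)%VS.

Definition collinear (F : finFieldType) (P Q R : point F) : Prop :=
  exists l : line F, [/\ on_line P l, on_line Q l & on_line R l].

Definition arc (F : finFieldType) (K : {set point F}) : Prop :=
  forall P Q R : point F, P \in K -> Q \in K -> R \in K ->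
    P != Q -> P != R -> Q != R -> ~ collinear P Q R.

Definition secant (F : finFieldType) (K : {set point F}) (l : line F) : Prop :=
  exists P Q : point F,
    [/\ P \in K, Q \in K, P != Q, on_line P l & on_line Q l].

Definition blocking_set (F : finFieldType) (K B : {set point F}) : Prop :=
  [disjoint B & K] /\
  forall l : line F, secant K l -> exists2 P, P \in B & on_line P l.

(* #|B| = #|K| - 1, written without truncated subtraction. *)
Definition min_blocking_set (F : finFieldType) (K B : {set point F}) : Prop :=
  blocking_set K B /\ #|B|.+1 = #|K|.

Section LineAtInfinity.
Variable F : finFieldType.

Definition coord3 (v : 'rV[F]_3) : F^o := v 0 2.

Lemma coord3_is_linear : linear coord3.
Proof. by move=> a u v; rewrite /coord3 !mxE. Qed.

HB.instance Definition _ :=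
  GRing.isLinear.Build F 'rV[F]_3 F^o _ coord3 coord3_is_linear.

Lemma dim_ker_coord3 : \dim (lker (linfun coord3)) == 2%N.
Proof.
have := limg_ker_dim (linfun coord3) fullv.
suff -> : (linfun coord3 @: fullv)%VS = fullv.
  by rewrite capfv !dimvf /dim /= addn1 => -[/eqP].
apply/eqP; rewrite eqEsubv subvf; apply/subvP => c _.
apply/memv_imgP; exists (c *: delta_mx 0 2); first exact: memvf.
by rewrite lfunE /= /coord3 !mxE !eqxx /= mulr1.
Qed.

Definition line_infty : line F := Line dim_ker_coord3.

End LineAtInfinity.

Section Translation.
Variable F : finFieldType.

Definition translation_vec (A : F * F) (v : 'rV[F]_3) : 'rV[F]_3 :=
  \row_(i < 3) [:: v 0 0 + A.1 * v 0 2; v 0 1 + A.2 * v 0 2; v 0 2]`_i.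

Lemma translation_vec_is_linear A : linear (translation_vec A).
Proof.
by move=> a u v; apply/rowP => -[[|[|[|//]]] ?];
  rewrite !mxE //= !mulrDr mulrCA addrACA.
Qed.

HB.instance Definition _ A := GRing.isLinear.Build F 'rV[F]_3 'rV[F]_3 _
  (translation_vec A) (translation_vec_is_linear A).

Lemma dim_translation A (P : point F) :
  \dim (linfun (translation_vec A) @: P) == 1%N.
Proof.
rewrite limg_dim_eq ?dim_point //.
suff /eqP-> : lker (linfun (translation_vec A)) == 0%VS by rewrite capv0.
rewrite -subv0; apply/subvP => v; rewrite memv_ker memv0 lfunE /= => /eqP/rowP e.
have v2 : v 0 2 = 0 by have := e 2; rewrite !mxE.
have v0 : v 0 0 = 0 by have := e 0; rewrite !mxE /= v2 mulr0 addr0.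
have v1 : v 0 1 = 0 by have := e 1; rewrite !mxE /= v2 mulr0 addr0.
apply/eqP/rowP => -[[|[|[|//]]] lti]; rewrite mxE.
- by rewrite -[RHS]v0; congr (v _ _); apply: val_inj.
- by rewrite -[RHS]v1; congr (v _ _); apply: val_inj.
- by rewrite -[RHS]v2; congr (v _ _); apply: val_inj.
Qed.

Definition translation (A : F * F) (P : point F) : point F :=
  Point (dim_translation A P).

End Translation.

Definition translation_orbit (F : finFieldType) (G : {set F * F})
    (P : point F) : {set point F} :=
  [set translation A P | A in G].

Definition translation_arc (F : finFieldType) (K : {set point F}) : Prop :=
  arc K /\
  exists (G : {set F * F}) (P : point F),
    [/\ zmod_closed G, ~~ on_line P (line_infty F) & K = translation_orbit G P].

(* Main.v *)
(** Write the arc as the orbit of [P = <v>] under [G], and send each non-zero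
    [A] in [G] to its direction, the point [(A.1 : A.2 : 0)] at infinity.  Two
    distinct non-zero [A], [A'] with the same direction would make [P],
    [phi_A(P)] and [phi_A'(P)] collinear, so in an arc the directions are
    pairwise distinct and there are [#|G| - 1 = #|K| - 1] of them.  The secant
    through [phi_A(P)] and [phi_A'(P)] passes through the direction of
    [A - A'], which is again a non-zero element of [G]. *)
Require Import Defs.
From HB Require Import structures.
From mathcomp Require Import all_boot all_order all_algebra.

Section Directions.
Local Set Implicit Arguments.
Local Unset Strict Implicit.
Import GRing.Theory.
Local Open Scope ring_scope.
Variable F : finFieldType.
Implicit Types (A : F * F) (P Q : point F) (v : 'rV[F]_3) (l : line F).

(** Passes from subspaces to coordinates: every later argument about a point is carried out on a
    generator [v]. *)
Lemma point_vline P : exists2 v, v != 0 & point_space P = <[v]>%VS.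
Proof.
have P1 := eqP (dim_point P).
have v0 : vpick P != 0 by rewrite vpick0 -dimv_eq0 P1.
exists (vpick P) => //; apply/esym/eqP.
by rewrite eqEdim dim_vline v0 P1 -memvE memv_pick.
Qed.

Lemma on_line_vline P l v : point_space P = <[v]>%VS ->
  on_line P l = (v \in (l : {vspace _})).
Proof. by rewrite /on_line => ->; rewrite memvE. Qed.

Lemma mem_line_infty v : (v \in (line_infty F : {vspace _})) = (v 0 2 == 0).
Proof. by rewrite /line_infty /= memv_ker lfunE. Qed.

Definition direction_vec A : 'rV[F]_3 := \row_(i < 3) [:: A.1; A.2; 0]`_i.

Lemma direction_vec_is_additive : zmod_morphism direction_vec.
Proof.
by move=> A B; apply/rowP => -[[|[|[|//]]] ?]; rewrite !mxE //= subr0.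
Qed.

HB.instance Definition _ := GRing.isZmodMorphism.Build (F * F)%type 'rV[F]_3
  direction_vec direction_vec_is_additive.

Lemma direction_vec_inj : injective direction_vec.
Proof.
move=> [a b] [a' b'] /rowP e; congr pair.
  by have := e 0; rewrite !mxE.
by have := e 1; rewrite !mxE.
Qed.

Lemma direction_vec_eq0 A : (direction_vec A == 0) = (A == 0).
Proof. by rewrite -(inj_eq direction_vec_inj) raddf0. Qed.

Lemma direction_vec_inf A : direction_vec A 0 2 = 0.
Proof. by rewrite mxE. Qed.

(** Translating adds a multiple of the direction vector, with factor the third coordinate; for a
    point off [line_infty] this factor is non-zero, so a translation can be read back from its
    effect on [v]. *)
Lemma translation_vecE A v :
  translation_vec A v = v + v 0 2 *: direction_vec A.
Proof.
apply/rowP => -[[|[|[|//]]] lti]; rewrite !mxE /= mulrC ?mul0r ?addr0;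
  try (congr (_ + _)); by [congr (v _ _); apply: val_inj | rewrite mulrC].
Qed.

Lemma translation_vline A P v : point_space P = <[v]>%VS ->
  point_space (translation A P) = <[(v + v 0 2 *: direction_vec A)%R]>%VS.
Proof. by move=> /= ->; rewrite limg_line lfunE /= translation_vecE. Qed.

Lemma translation_coord3 A v :
  (v + v 0 2 *: direction_vec A) 0 2 = v 0 2.
Proof. by rewrite mxE mxE direction_vec_inf mulr0 addr0. Qed.

Lemma translation0 P : translation 0 P = P.
Proof.
have [v _ Pv] := point_vline P; apply: val_inj => /=.
by rewrite -[LHS]/(point_space (translation 0 P)) (translation_vline 0 Pv)
  raddf0 scaler0 addr0.
Qed.

(** Equal image points only have proportional generators. Both generators have the same third
    coordinate [v 0 2], which is non-zero, so the factor [k] is 1 and the direction vectors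
    agree. *)
Lemma translation_inj P : ~~ on_line P (line_infty F) ->
  injective (fun A => translation A P).
Proof.
have [v _ Pv] := point_vline P.
rewrite (on_line_vline _ Pv) mem_line_infty => c0 A B eAB.
have : v + v 0 2 *: direction_vec A \in <[(v + v 0 2 *: direction_vec B)%R]>%VS.
  by rewrite -(translation_vline _ Pv) -eAB (translation_vline _ Pv) memv_line.
case/vlineP=> k ek; move/rowP/(_ 2): (ek).
rewrite translation_coord3 mxE translation_coord3 => /eqP.
rewrite -{1}[v 0 2]mul1r (inj_eq (mulIf c0)) => /eqP k1.
move: ek; rewrite -k1 scale1r => /addrI /(scalerI c0).
exact: direction_vec_inj.
Qed.

(* The base point [P] is only the junk value at [A = 0]. *)
Definition direction P A : point F := insubd P <[direction_vec A]>%VS.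

Lemma direction_vline P A : A != 0 ->
  point_space (direction P A) = <[direction_vec A]>%VS.
Proof. by move=> A0; rewrite [LHS]insubdK // unfold_in dim_vline direction_vec_eq0 A0. Qed.

Lemma direction_on_line_infty P A : A != 0 ->
  on_line (direction P A) (line_infty F).
Proof.
move=> A0; rewrite (on_line_vline _ (direction_vline P A0)).
by rewrite mem_line_infty direction_vec_inf.
Qed.

Lemma translation_off_line_infty A P : ~~ on_line P (line_infty F) ->
  ~~ on_line (translation A P) (line_infty F).
Proof.
have [v _ Pv] := point_vline P.
rewrite (on_line_vline _ Pv) (on_line_vline _ (translation_vline A Pv)).
by rewrite !mem_line_infty translation_coord3.
Qed.

(** Subtracting the generators of the two translates cancels [v] and leaves the direction vector of
    [A - B] scaled by [v 0 2], which is invertible. *)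
Lemma direction_on_secant P A B l : ~~ on_line P (line_infty F) -> A != B ->
  on_line (translation A P) l -> on_line (translation B P) l ->
  on_line (direction P (A - B)) l.
Proof.
have [v _ Pv] := point_vline P.
rewrite (on_line_vline _ Pv) mem_line_infty => c0 AB.
rewrite !(on_line_vline _ (translation_vline _ Pv)) => lA lB.
have AB0 : A - B != 0 by rewrite subr_eq0.
rewrite (on_line_vline _ (direction_vline P AB0)) raddfB.
have := memvB lA lB; rewrite opprD addrACA subrr add0r -scalerBr rpredZeq.
by rewrite (negPf c0).
Qed.

(** The witness is the line joining [P] to the common direction: both translates differ from [v] by
    a multiple of that direction vector. *)
Lemma collinear_same_direction P A B : ~~ on_line P (line_infty F) ->
  A != 0 -> B != 0 -> direction P A = direction P B ->
  collinear P (translation A P) (translation B P).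
Proof.
have [v _ Pv] := point_vline P.
rewrite (on_line_vline _ Pv) mem_line_infty => c0 A0 B0 eAB.
have dirAB : <[direction_vec A]>%VS = <[direction_vec B]>%VS.
  by rewrite -!(direction_vline P) // eAB.
have dim2 : \dim (<[v]> + <[direction_vec A]>)%VS == 2%N.
  rewrite dimv_disjoint_sum ?dim_vline.
    have -> : v != 0 by apply: contraNneq c0 => ->; rewrite mxE.
    by rewrite direction_vec_eq0 A0.
  (* A common vector is [k *: v] and has third coordinate 0, like every direction vector; as [v 0 2]
     is non-zero, [k] vanishes. *)
  apply/eqP; rewrite -subv0; apply/subvP => w.
  rewrite memv_cap memv0 => /andP[/vlineP[k ->] /vlineP[m]].
  move/rowP/(_ 2); rewrite mxE [in RHS]mxE direction_vec_inf mulr0 => /eqP.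
  by rewrite mulf_eq0 (negPf c0) orbF => /eqP ->; rewrite scale0r.
exists (Line dim2).
rewrite (on_line_vline _ Pv) !(on_line_vline _ (translation_vline _ Pv)) /=.
have lv : v \in (<[v]> + <[direction_vec A]>)%VS.
  by apply: (subvP (addvSl _ _)); apply: memv_line.
have lA : direction_vec A \in (<[v]> + <[direction_vec A]>)%VS.
  by apply: (subvP (addvSr _ _)); apply: memv_line.
have lB : direction_vec B \in (<[v]> + <[direction_vec A]>)%VS.
  by apply: (subvP (addvSr _ _)); rewrite dirAB memv_line.
by split=> //; apply: memvD => //; apply: memvZ.
Qed.

Lemma direction_inj (G : {set F * F}) P :
  0 \in G -> ~~ on_line P (line_infty F) -> Defs.arc (translation_orbit G P) ->
  {in G :\ (0 : F * F) &, injective (direction P)}.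
Proof.
move=> G0 Pinf arcK A B; rewrite !inE => /andP[A0 AG] /andP[B0 BG] eAB.
apply/eqP/negP => /negP AB; have tinj := inj_eq (translation_inj Pinf).
(* [P] counts as a third arc point, being its own translate by 0; it differs from the other two
   because [A] and [B] are non-zero. *)
apply: (arcK _ _ _ _ _ _ _ _ _ (collinear_same_direction Pinf A0 B0 eAB)).
- by apply/imsetP; exists 0; rewrite ?translation0.
- exact: imset_f.
- exact: imset_f.
- by rewrite -[X in X != _](translation0 P) tinj eq_sym.
- by rewrite -[X in X != _](translation0 P) tinj eq_sym.
- by rewrite tinj.
Qed.

Lemma directions_min_blocking (G : {set F * F}) P :
  zmod_closed G -> ~~ on_line P (line_infty F) ->
  Defs.arc (translation_orbit G P) ->
  min_blocking_set (translation_orbit G P) (direction P @: (G :\ (0 : F * F))).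
Proof.
move=> [G0 GB] Pinf arcK; split; last first.
  (* Both cardinalities are computed in [G]: the arc has [#|G|] points, and the missing direction of
     0 accounts for the successor. *)
  rewrite (card_in_imset (direction_inj G0 Pinf arcK)).
  by rewrite (card_imset _ (translation_inj Pinf)) (cardsD1 (0 : F * F) G) G0.
split.
  (* Disjointness: directions lie at infinity, whereas translates of [P] stay affine. *)
  apply/pred0P => Q /=; apply/negP => /andP[/imsetP[A AG ->] /imsetP[B _ e]].
  have := translation_off_line_infty B Pinf; rewrite -e.
  by rewrite direction_on_line_infty //; case/setD1P: AG.
move=> l [_ [_ [/imsetP[A AG ->] /imsetP[B BG ->] AB lA lB]]].
have {}AB : A != B by apply: contraNneq AB => ->.
exists (direction P (A - B)); last exact: direction_on_secant.
by apply: imset_f; rewrite !inE subr_eq0 AB; exact: GB.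
Qed.

End Directions.

Theorem proposition3p1 (F : finFieldType) (r : nat) (hq : #|F| = 2 ^ r)
    (K : {set point F}) (hK : translation_arc K) :
  exists B : {set point F},
    min_blocking_set K B /\
    (forall P : point F, P \in B -> on_line P (line_infty F)).
Proof.
case: hK => arcK [G [P [Gz Pinf defK]]]; rewrite {}defK in arcK *.
exists (direction P @: (G :\ (0 : F * F)%R)); split; first exact: directions_min_blocking.
by move=> _ /imsetP[A /setD1P[A0 _] ->]; apply: direction_on_line_infty.
Qed.
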